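(* Let $A \in \mathbb{R}^{n \times n}$ be symmetric positive semidefinite, $\mathbf{b} \in \mathbb{R}^n$, $c \in \mathbb{R}$, and $f(\mathbf{x}) = \frac{1}{2}\mathbf{x}^{\top} A \mathbf{x} + \mathbf{b}^{\top}\mathbf{x} + c$. Let $\Gamma \in \mathbb{R}^{n\times n}$ be a diagonal positive definite matrix. For $p > 0$, let $\tilde f(\mathbf{x}) := f(\mathbf{x}) + \frac{p}{2}\mathbf{x}^{\top}\Gamma^{-1}\mathbf{x}$ and $$\tilde\Phi(\mathbf{x}) := \Gamma \nabla \tilde f(\mathbf{x}) = (\Gamma A + p I)\mathbf{x} + \Gamma \mathbf{b}.$$ Let $$M := \tfrac{1}{2}(\Gamma A + A \Gamma)$$ and let $\lambda_{\min}$ be the smallest eigenvalue of $M$. If $p > \max\{0, -\lambda_{\min}\}$, then $\tilde\Phi$ is strongly monotone with parameter $\eta := p + \min\{0, \lambda_{\min}\}$.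
   Context: A map $\Psi : \mathbb{R}^n \to \mathbb{R}^n$ is strongly monotone with parameter $\eta > 0$ if $(\Psi(\mathbf{x}_1) - \Psi(\mathbf{x}_2))^{\top}(\mathbf{x}_1 - \mathbf{x}_2) \geq \eta \|\mathbf{x}_1 - \mathbf{x}_2\|_2^2$ for all $\mathbf{x}_1, \mathbf{x}_2 \in \mathbb{R}^n$. *)

(* Defs.v *)
From mathcomp Require Import all_boot all_order all_algebra.
From mathcomp Require Import all_classical all_reals all_analysis.

Set Implicit Arguments.
Unset Strict Implicit.
Unset Printing Implicit Defensive.

Import Order.TTheory GRing.Theory Num.Theory.
Import numFieldNormedType.Exports.

Local Open Scope ring_scope.

Definition dotv (R : realType) (n : nat) (u v : 'cV[R]_n) : R :=
  (u^T *m v) 0 0.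

(* The library norm `|x| on 'cV[R]_n is the max norm, so the Euclidean norm has
   to be introduced separately. *)
Definition norm2 (R : realType) (n : nat) (x : 'cV[R]_n) : R :=
  Num.sqrt (\sum_(i < n) x i 0 ^+ 2).

Definition possemidefmx (R : realType) (n : nat) (A : 'M[R]_n) : Prop :=
  A \is symmetricmx /\ forall x : 'cV[R]_n, 0 <= dotv x (A *m x).

Definition posdefmx (R : realType) (n : nat) (A : 'M[R]_n) : Prop :=
  A \is symmetricmx /\ forall x : 'cV[R]_n, x != 0 -> 0 < dotv x (A *m x).

(* [eigenvalue] only ranges over real eigenvalues; a real symmetric matrix has
   no others. *)
Definition smallest_eigenvalue (R : realType) (n : nat) (A : 'M[R]_n) (l : R)
    : Prop :=
  eigenvalue A l /\ forall m : R, eigenvalue A m -> l <= m.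

Definition gradient (R : realType) (n : nat) (f : 'cV[R]_n -> R)
    (x : 'cV[R]_n) : 'cV[R]_n :=
  \col_(i < n) 'D_(delta_mx i 0) f x.

Definition strongly_monotone (R : realType) (n : nat)
    (Psi : 'cV[R]_n -> 'cV[R]_n) (eta : R) : Prop :=
  0 < eta /\
  forall x1 x2 : 'cV[R]_n,
    eta * norm2 (x1 - x2) ^+ 2 <= dotv (Psi x1 - Psi x2) (x1 - x2).

Definition quadratic (R : realType) (n : nat) (A : 'M[R]_n) (b : 'cV[R]_n)
    (c : R) (x : 'cV[R]_n) : R :=
  2^-1 * dotv x (A *m x) + dotv b x + c.

Definition regularized (R : realType) (n : nat) (f : 'cV[R]_n -> R)
    (G : 'M[R]_n) (p : R) (x : 'cV[R]_n) : R :=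
  f x + p / 2 * dotv x (invmx G *m x).

(* Main.v *)
(* [dotv (G *m A *m d) d] depends only on the symmetric part of [G *m A], which
   is M. The Rayleigh bound [lmin * dotv d d <= dotv d (M *m d)] comes from the
   unitary diagonalization of M over R[i]: the diagonal entries are real, hence
   eigenvalues of M over R. *)
Require Import Defs.
From mathcomp Require Import all_boot all_order all_algebra.
From mathcomp Require Import all_classical all_reals all_analysis.
From mathcomp Require Import ring lra.
From mathcomp Require complex.

Import Order.TTheory GRing.Theory Num.Theory.
Import numFieldNormedType.Exports.

Local Open Scope ring_scope.

Section DotProduct.
Context {R : realType} {n : nat}.
Implicit Types (u v w : 'cV[R]_n) (A : 'M[R]_n).

Lemma dotvE u v : dotv u v = \sum_i u i 0 * v i 0.
Proof. by rewrite /dotv mxE; apply: eq_bigr => i _; rewrite mxE. Qed.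

Lemma dotvC u v : dotv u v = dotv v u.
Proof. by rewrite !dotvE; apply: eq_bigr => i _; rewrite mulrC. Qed.

Lemma dotvDr u v w : dotv u (v + w) = dotv u v + dotv u w.
Proof. by rewrite /dotv mulmxDr mxE. Qed.

Lemma dotvDl u v w : dotv (v + w) u = dotv v u + dotv w u.
Proof. by rewrite dotvC dotvDr !(dotvC u). Qed.

Lemma dotvZr u v a : dotv u (a *: v) = a * dotv u v.
Proof. by rewrite /dotv -scalemxAr mxE. Qed.

Lemma dotvZl u v a : dotv (a *: u) v = a * dotv u v.
Proof. by rewrite dotvC dotvZr dotvC. Qed.

Lemma dotv_mulmxr u v A : dotv u (A *m v) = dotv (A^T *m u) v.
Proof. by rewrite /dotv trmx_mul trmxK mulmxA. Qed.

Lemma dotv_delta i u : dotv (delta_mx i 0) u = u i 0.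
Proof. by rewrite /dotv trmx_delta -rowE mxE. Qed.

Lemma norm2_sqr u : norm2 u ^+ 2 = dotv u u.
Proof.
rewrite /norm2 sqr_sqrtr; last by apply: sumr_ge0 => i _; exact: sqr_ge0.
by rewrite dotvE; apply: eq_bigr => i _; rewrite expr2.
Qed.

Lemma symmetricmx_trmx A : A \is symmetricmx -> A^T = A.
Proof. by move=> /is_hermitianmxP {2}->; rewrite expr0 scale1r map_mx_id. Qed.

(** A singular matrix has a nonzero row vector [v] with [v *m A = 0], and the form would vanish at
    [v^T]. *)
Lemma posdefmx_unit A : posdefmx A -> A \in unitmx.
Proof.
move=> [/symmetricmx_trmx As Apos]; rewrite unitmxE unitfE; apply/negP => /det0P[v v0 vA].
have := Apos v^T; rewrite dotv_mulmxr -trmx_mul vA trmx0 trmx_eq0 v0.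
by move=> /(_ isT); rewrite /dotv trmx0 mul0mx mxE ltxx.
Qed.

End DotProduct.

Section Gradient.
Local Open Scope classical_set_scope.
Context {R : realType} {n : nat}.

(** For [h != 0] the difference quotient is exactly [g + h * q], which tends to [g]. This reduces
    gradients of quadratics to reading off a linear coefficient. *)
Lemma derive_quadratic_expansion (f : 'cV[R]_n -> R) (x v : 'cV[R]_n) (g q : R) :
  (forall h, f (h *: v + x) = f x + h * g + h ^+ 2 * q) -> 'D_v f x = g.
Proof.
move=> fE; apply: cvg_lim => //.
have gq : (fun h : R => g + h * q) @ 0^' --> g + 0 * q.
  apply: (@cvg_trans _ ((fun h : R => g + h * q) @ nbhs 0)).
    by apply: cvg_app; exact: nbhs_dnbhs.
  by apply: cvgD; [exact: cvg_cst | apply: cvgMr_tmp; exact: cvg_id].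
rewrite mul0r addr0 in gq.
apply: cvg_trans gq; apply: near_eq_cvg; near=> h.
have h0 : h != 0 by near: h; exact: nbhs_dnbhs_neq.
rewrite /= fE [_ *: _]/GRing.scale /=.
by field.
Unshelve. all: by end_near. Qed.

Lemma gradient_quadratic (A : 'M[R]_n) b c x :
  A^T = A -> gradient (quadratic A b c) x = A *m x + b.
Proof.
move=> As; apply/colP => i; rewrite mxE.
(* Only the coefficient of [h ^+ 2] has to be supplied; symmetry of [A] merges the two cross terms
   into the linear coefficient. *)
apply: (derive_quadratic_expansion _ _ _ _
  (2^-1 * dotv (delta_mx i 0) (A *m delta_mx i 0))) => h.
rewrite mxE -!dotv_delta /quadratic !mulmxDr -!scalemxAr !(dotvDl, dotvDr, dotvZl, dotvZr).
rewrite (dotv_mulmxr x (delta_mx i 0)) As (dotvC (A *m x)) (dotvC b (delta_mx _ _)).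
by field.
Qed.

(** The penalty is absorbed into the quadratic part, so that [gradient_quadratic] covers the
    regularized function too. *)
Lemma regularized_quadratic (A G : 'M[R]_n) b c p :
  regularized (quadratic A b c) G p = quadratic (A + p *: invmx G) b c.
Proof.
apply/funext => x; rewrite /regularized /quadratic mulmxDl dotvDr -scalemxAl dotvZr.
by field.
Qed.

End Gradient.

Section Rayleigh.
Context {R : realType} {n : nat}.
Import complex.
Local Notation C := (complex R).
Local Notation toC := (real_complex R).

Lemma rayleigh_lower_bound (M : 'M[R]_n) (l : R) (x : 'cV[R]_n) :
  M^T = M -> (forall m, eigenvalue M m -> l <= m) ->
  l * dotv x x <= dotv x (M *m x).
Proof.
move=> Ms lM.
pose N : 'M[C]_n := map_mx toC M.
have Nherm : N \is hermsymmx.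
  apply: realsym_hermsym.
    apply/is_hermitianmxP; rewrite expr0 scale1r map_mx_id //.
    by apply/matrixP => i j; rewrite !mxE -{1}Ms mxE.
  by apply/mxOverP => i j; rewrite mxE; apply/complex_realP; exists (M i j).
have /hermitian_normalmx/orthomx_spectralP := Nherm.
have Dreal := hermitian_spectral_diag_real Nherm.
have := spectral_unitarymx N; have := spectral_unit N.
move: Dreal; move: (spectralmx N) (spectral_diag N) => P D Dreal Punit Puni NE.
(* From [N = invmx P *m diag_mx D *m P] follows [P *m N = diag_mx D *m P]: row [i] of [P] is a left
   eigenvector of [N] for [D 0 i]. As this value is real, [eigenvalue_map] brings it down to an
   eigenvalue of [M] over [R]. *)
have lD i : toC l <= D 0 i.
  have /mxOverP/(_ 0 i)/complex_realP[d dE] := Dreal.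
  rewrite dE lecR; apply: lM; rewrite -(eigenvalue_map toC); apply/eigenvalueP.
  exists (row i P).
    rewrite -[map_mx _ M]/N NE !mulmxA -row_mul mulmxV //.
    rewrite -[RHS]/(toC d *: row i P) -dE.
    by rewrite row1 -rowE row_diag_mx -scalemxAl -rowE.
  (* A zero row of [P] would make row [i] of [P *m invmx P = 1] vanish, although its diagonal entry
     is 1. *)
  apply/eqP => Pi0; have /(congr1 (row i)) := mulmxV Punit.
  by rewrite row_mul Pi0 mul0mx => /rowP/(_ i)/eqP; rewrite !mxE eqxx eq_sym oner_eq0.
(* [y] holds the coordinates of [x] in the eigenbasis. Since [z] is real and [P] unitary,
   [z^T *m invmx P] is the conjugate transpose of [y], so both forms become weighted sums of
   [|y i 0| ^ 2]. *)
pose z : 'cV[C]_n := map_mx toC x; pose y := P *m z.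
have zE : map_mx Num.conj z = z.
  by apply/colP => i; rewrite !mxE; apply/CrealP/complex_realP; exists (x i 0).
have ytE : z^T *m invmx P = (map_mx Num.conj y)^T.
  rewrite invmx_unitary // /y map_mxM trmx_mul zE; congr (_ *m _).
  by apply/matrixP => i j; rewrite !mxE.
have xMx : toC (dotv x (M *m x)) = \sum_i D 0 i * `|y i 0| ^+ 2.
  have -> : toC (dotv x (M *m x)) = (z^T *m (N *m z)) 0 0.
    by rewrite /z map_trmx -!map_mxM [RHS]mxE.
  rewrite NE -!mulmxA mulmxA ytE -/y mxE; apply: eq_bigr => i _.
  by rewrite mul_diag_mx !mxE normCK mulrCA; congr (_ * _); exact: mulrC.
have xx : toC (dotv x x) = \sum_i `|y i 0| ^+ 2.
  have -> : toC (dotv x x) = (z^T *m z) 0 0.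
    by rewrite /z map_trmx -!map_mxM [RHS]mxE.
  rewrite -[X in _ *m X](mulKmx Punit) -/y mulmxA ytE mxE; apply: eq_bigr => i _.
  by rewrite !mxE normCK; exact: mulrC.
rewrite -lecR rmorphM /= xMx xx mulr_sumr; apply: ler_sum => i _.
by rewrite ler_wpM2r // exprn_ge0.
Qed.

End Rayleigh.

Theorem proposition2 (R : realType) (n : nat) (A : 'M[R]_n) (b : 'cV[R]_n)
    (c : R) (G : 'M[R]_n) (p lmin : R) :
  possemidefmx A ->
  is_diag_mx G -> posdefmx G ->
  0 < p ->
  let f := quadratic A b c in
  let f_tilde := regularized f G p in
  let Phi_tilde := fun x : 'cV[R]_n => G *m gradient f_tilde x in
  let M := 2^-1 *: (G *m A + A *m G) in
  (forall x : 'cV[R]_n, Phi_tilde x = (G *m A + p%:M) *m x + G *m b) /\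
  (smallest_eigenvalue M lmin ->
   Num.max 0 (- lmin) < p ->
   strongly_monotone Phi_tilde (p + Num.min 0 lmin)).
Proof.
move=> [/symmetricmx_trmx As _] _ Gpos p0 f f_tilde Phi_tilde M.
have Gu := posdefmx_unit _ Gpos; have [/symmetricmx_trmx Gs _] := Gpos.
have PhiE x : Phi_tilde x = (G *m A + p%:M) *m x + G *m b.
  rewrite /Phi_tilde /f_tilde regularized_quadratic gradient_quadratic; last first.
    by rewrite linearD linearZ /= trmx_inv Gs As.
  by rewrite mulmxDr mulmxA mulmxDr -scalemxAr mulmxV // scalemx1.
split=> // -[_ lmin_le]; rewrite gt_max => /andP[_ lp]; split.
  (* The two values of the minimum give [0 < p] and [0 < p + lmin]. *)
  by rewrite /Num.min; case: ifP => _; lra.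
move=> x1 x2; rewrite !PhiE opprD addrACA subrr addr0 -mulmxBr.
move: (x1 - x2) => d; rewrite norm2_sqr mulmxDl dotvDl mul_scalar_mx dotvZl.
(* The forms of [G *m A] and of its transpose [A *m G] agree at [d], hence both equal the form of
   their average. *)
have -> : dotv (G *m A *m d) d = dotv d (M *m d).
  rewrite /M -scalemxAl mulmxDl dotvZr dotvDr (dotvC d (G *m A *m d)).
  rewrite (dotv_mulmxr d d) trmx_mul As Gs.
  by field.
have Ms : M^T = M by rewrite /M linearZ linearD /= !trmx_mul As Gs addrC.
have := rayleigh_lower_bound _ _ d Ms lmin_le.
have dd : 0 <= dotv d d by rewrite -norm2_sqr sqr_ge0.
(* The Rayleigh bound holds with [lmin] itself; it is weakened here to the minimum in the claimed
   parameter. *)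
have : Num.min 0 lmin * dotv d d <= lmin * dotv d d.
  by rewrite ler_wpM2r // ge_min lexx orbT.
by rewrite mulrDl; lra.
Qed.
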